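(* Let $(X,\mathcal{A},\mu)$ be a $\sigma$-finite measure space and let $(A_n)_{n\in\mathbb{N}}$ be measurable sets of finite measure with $A_n\subseteq A_{n+1}$ for all $n$ and $X=\bigcup_{n=1}^\infty A_n$. Let $\mathcal{S}$ be the set of all measurable simple functions belonging to $L^1(X)$, and let $D:\mathcal{S}\to L^1(X)$ be a linear map. Then $D$ has a unique extension to a doubly stochastic operator on $L^1(X)$ if and only if $D$ is nonnegative (maps nonnegative functions to nonnegative functions) and for every $E\in\mathcal{A}$ with $\mu(E)<\infty$: $$\int_X D\chi_E\,d\mu=\mu(E)\qquad\text{and}\qquad \lim_{n\to\infty}\int_X \chi_E\, D\chi_{A_n}\,d\mu=\mu(E).$$
   Context: A Markov operator on $L^1(X)$ is a positive linear operator $T:L^1(X)\to L^1(X)$ with $\int_X Tf\,d\mu=\int_X f\,d\mu$ for all $f\in L^1(X)$. A Markov operator $T$ is semi-doubly stochastic if $\int_X T^*\chi_E\,d\mu\le\mu(E)$ for every $E\in\mathcal{A}$ with $\mu(E)<\infty$, where $T^*:L^\infty(X)\to L^\infty(X)$ is the Banach adjoint. A semi-doubly stochastic operator $T$ is doubly stochastic if $\int_X T^*g\,d\mu=\int_X g\,d\mu$ for each $g\in L^\infty(X)$. $\chi_E$ denotes the indicator function of $E$. *)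

(* Defs.v *)
(* Elements of L^1(X) / L^infty(X) are represented by real-valued functions
   (representatives); all equalities/inequalities between them are a.e.
   Operators on L^1 are maps on representatives that are well defined
   modulo a.e. equality on integrable functions. *)
From HB Require Import structures.
From mathcomp Require Import all_boot all_order all_algebra.
From mathcomp Require Import all_classical all_reals all_analysis.
Set Implicit Arguments. Unset Strict Implicit. Unset Printing Implicit Defensive.
Import Order.TTheory GRing.Theory Num.Theory.
Import numFieldNormedType.Exports.
Local Open Scope classical_set_scope.
Local Open Scope ring_scope.

Section Defs.
Context {d : measure_display} {T : measurableType d} {R : realType}.
Variable mu : {measure set T -> \bar R}.

Definition L1 (f : T -> R) : Prop := mu.-integrable setT (EFin \o f).

Definition Linf (g : T -> R) : Prop :=
  measurable_fun setT g /\ exists M : R, {ae mu, forall x, `|g x| <= M}.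

Definition simpleL1 (s : T -> R) : Prop :=
  measurable_fun setT s /\ finite_set (range s) /\ L1 s.

Definition L1_linear_op (Top : (T -> R) -> (T -> R)) : Prop :=
  (forall f, L1 f -> L1 (Top f)) /\
  (forall f g, L1 f -> L1 g -> {ae mu, forall x, f x = g x} ->
     {ae mu, forall x, Top f x = Top g x}) /\
  (forall (a : R) f g, L1 f -> L1 g ->
     {ae mu, forall x, Top (fun y => a * f y + g y) x = a * Top f x + Top g x}).

Definition markov_op (Top : (T -> R) -> (T -> R)) : Prop :=
  L1_linear_op Top /\
  (forall f, L1 f -> {ae mu, forall x, 0 <= f x} ->
     {ae mu, forall x, 0 <= Top (f) x}) /\
  (forall f, L1 f ->
     (\int[mu]_x (Top f x)%:E = \int[mu]_x (f x)%:E)%E).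

(* h represents T^* g, the Banach adjoint T^* : L^infty -> L^infty
   applied to g : <T^* g, f> = <g, T f> for all f in L^1 *)
Definition adjoint_at (Top : (T -> R) -> (T -> R)) (g h : T -> R) : Prop :=
  Linf h /\
  forall f, L1 f ->
    (\int[mu]_x (h x * f x)%:E = \int[mu]_x (g x * Top f x)%:E)%E.

Definition semi_doubly_stochastic (Top : (T -> R) -> (T -> R)) : Prop :=
  markov_op Top /\
  forall E, measurable E -> (mu E < +oo)%E ->
    forall h, adjoint_at Top (\1_E) h ->
      (\int[mu]_x (h x)%:E <= mu E)%E.

(* the identity  int T^* g = int g  is required for every g in L^infty for
   which  int g  is defined (positive or negative part of finite integral) *)
Definition doubly_stochastic (Top : (T -> R) -> (T -> R)) : Prop :=
  semi_doubly_stochastic Top /\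
  forall g, Linf g ->
    ((\int[mu]_x (Num.max (g x) 0)%:E < +oo)%E \/ (\int[mu]_x (Num.max (- g x) 0)%:E < +oo)%E) ->
    forall h, adjoint_at Top g h ->
      (\int[mu]_x (h x)%:E = \int[mu]_x (g x)%:E)%E.

Definition simple_linear_map (D : (T -> R) -> (T -> R)) : Prop :=
  (forall s, simpleL1 s -> L1 (D s)) /\
  (forall s t, simpleL1 s -> simpleL1 t -> {ae mu, forall x, s x = t x} ->
     {ae mu, forall x, D s x = D t x}) /\
  (forall (a : R) s t, simpleL1 s -> simpleL1 t ->
     {ae mu, forall x, D (fun y => a * s y + t y) x = a * D s x + D t x}).

Definition extends (Top D : (T -> R) -> (T -> R)) : Prop :=
  forall s, simpleL1 s -> {ae mu, forall x, Top s x = D s x}.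

Definition unique_ds_extension (D : (T -> R) -> (T -> R)) : Prop :=
  exists Top, doubly_stochastic Top /\ extends Top D /\
    forall Top', doubly_stochastic Top' -> extends Top' D ->
      forall f, L1 f -> {ae mu, forall x, Top' f x = Top f x}.

Definition nonneg_map (D : (T -> R) -> (T -> R)) : Prop :=
  forall s, simpleL1 s -> {ae mu, forall x, 0 <= s x} ->
    {ae mu, forall x, 0 <= D s x}.

End Defs.

(* Main.v *)
(** If [D] is positive and preserves the integral of indicators, then it is an
    [L^1]-contraction on simple functions, so it extends by density to a unique
    Markov operator. The limit condition forces [T 1_(A n)] to increase to [1]
    almost everywhere: every average over a set of finite measure does. Hence,
    for [h] representing [T^* g], both members of
    [int h 1_(A n) = int g (T 1_(A n))] converge by monotone convergence, and
    [int h = int g].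

    Conversely, for a doubly stochastic [T] the function [h = T^* 1_E] is
    obtained from the Radon-Nikodym theorem, and
    [int 1_E (T 1_(A n)) = int_(A n) h] tends to [int h = mu E]. *)
Require Import Defs.
From HB Require Import structures.
From mathcomp Require Import all_boot all_order all_algebra finmap.
From mathcomp Require Import all_classical all_reals all_analysis.
From mathcomp Require Import measurable_realfun ring lra.
Set Implicit Arguments. Unset Strict Implicit. Unset Printing Implicit Defensive.
Import Order.TTheory GRing.Theory Num.Theory.
Import numFieldNormedType.Exports.
Local Open Scope classical_set_scope.
Local Open Scope ring_scope.

(** * Integrable functions *)

(** [doubly_stochastic] constrains the functions [h] that represent an adjoint, without asserting
    that any exist. One direction therefore builds no adjoint; in the other the hypothesis says
    nothing about [\1_E] until a representative is exhibited. The functional to represent, the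
    integral of [T f] over [E], is controlled on L^1 only, and indicators of sets of infinite
    measure lie outside it. Hence Radon-Nikodym is applied inside each [A n], and the densities are
    glued by a monotone limit.

    A second obstacle is that [g] is merely essentially bounded. Monotone convergence is applied to
    positive and negative parts separately, which requires one of them to have finite integral. For
    [g] this is assumed; for [h] it has to be derived, and the bound [T 1_(A n) <= 1] is what makes
    this possible.

    Since operators act on representatives, the extension is first handled as a relation between [f]
    and its possible values. A single uniqueness statement for this relation then yields
    compatibility with null sets, linearity, and uniqueness of the extension. *)

Lemma ler_addgt0_twice {R : realType} (a b : R) :
  (forall e, 0 < e -> a <= b + 2 * e) -> a <= b.
Proof.
move=> ab; apply/ler_addgt0Pr => e e0; have e2 : 0 < e / 2 by lra.
by have := ab _ e2; lra.
Qed.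

Section L1_basics.
Context {d : measure_display} {T : measurableType d} {R : realType}.
Variable mu : {measure set T -> \bar R}.
Implicit Types (f g h s : T -> R).

Lemma L1_measurable f : L1 mu f -> measurable_fun setT f.
Proof. by move=> /measurable_int /measurable_EFinP. Qed.

Lemma L1_integralE f : L1 mu f ->
  (\int[mu]_x (f x)%:E = (\int[mu]_x f x)%:E)%E.
Proof. by move=> f1; rewrite fineK//; exact: (integrable_fin_num measurableT f1). Qed.

Lemma L1_ae_dominated f g : measurable_fun setT f -> L1 mu g ->
  {ae mu, forall x, `|f x| <= `|g x|} -> L1 mu f.
Proof.
move=> mf g1 fg; apply/integrableP; split; first exact/measurable_EFinP.
have /integrableP[mg] := g1; apply: le_lt_trans.
apply: ae_ge0_le_integral => //.
- by do 2 apply: measurableT_comp => //.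
- by apply: measurableT_comp.
- by apply: filterS fg => x fgx _ /=; rewrite lee_fin.
Qed.

Lemma L1_linear (a : R) f g : L1 mu f -> L1 mu g -> L1 mu (fun y => a * f y + g y).
Proof.
move=> f1 g1; rewrite /L1.
rewrite (_ : _ \o _ = (fun x => a%:E * (EFin \o f) x)%E \+ (EFin \o g))%E//.
by apply: integrableD => //; exact: integrableZl.
Qed.

Lemma L1_opp f : L1 mu f -> L1 mu (fun y => - f y).
Proof.
(* The coefficient is -2 because [-2 * f + f = - f], so one function fills both slots. The same
   device gives [a - 1] for scaling. *)
move=> f1; have := L1_linear (-2) f1 f1.
by congr L1; apply/funext => y; ring.
Qed.

Lemma L1_scale (a : R) f : L1 mu f -> L1 mu (fun y => a * f y).
Proof.
move=> f1; have := L1_linear (a - 1) f1 f1.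
by congr L1; apply/funext => y; ring.
Qed.

Lemma L1_add f g : L1 mu f -> L1 mu g -> L1 mu (fun y => f y + g y).
Proof.
move=> f1 g1; have := L1_linear 1 f1 g1.
by congr L1; apply/funext => y; ring.
Qed.

Lemma L1_sub f g : L1 mu f -> L1 mu g -> L1 mu (fun y => f y - g y).
Proof. by move=> f1 /L1_opp; exact: L1_add. Qed.

Lemma L1_norm f : L1 mu f -> L1 mu (fun y => `|f y|).
Proof. by move=> f1; exact: (integrable_norm f1). Qed.

Lemma L1_indic E : measurable E -> (mu E < +oo)%E -> L1 mu (\1_E).
Proof.
move=> mE muE; apply/integrableP; split; first exact/measurable_EFinP.
under eq_integral do rewrite /= ger0_norm//.
by rewrite integral_indic// setIT.
Qed.

Lemma Linf_indic E : measurable E -> Linf mu (\1_E).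
Proof.
move=> mE; split => //; exists 1; apply: aeW => x.
by rewrite indicE; case: (_ \in _); rewrite ?normr1 ?normr0.
Qed.

Lemma L1_mull g f : Linf mu g -> L1 mu f -> L1 mu (fun y => g y * f y).
Proof.
move=> [mg [M gM]] f1; apply: (@L1_ae_dominated _ (fun y => M * f y)).
- by apply: measurable_funM => //; exact: L1_measurable.
- exact: L1_scale.
- apply: filterS gM => x gM; rewrite !normrM ler_wpM2r//.
  by rewrite (le_trans gM)// ler_norm.
Qed.

Lemma Rintegral_linear (a : R) f g : L1 mu f -> L1 mu g ->
  \int[mu]_x (a * f x + g x) = a * \int[mu]_x f x + \int[mu]_x g x.
Proof.
move=> f1 g1; rewrite RintegralD//; last exact: (L1_scale a f1).
by rewrite RintegralZl.
Qed.

Lemma ae_eq_Rintegral f g : measurable_fun setT f -> measurable_fun setT g ->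
  {ae mu, forall x, f x = g x} -> \int[mu]_x f x = \int[mu]_x g x.
Proof.
move=> mf mg fg; congr fine; apply: ae_eq_integral => //;
  try exact/measurable_EFinP.
by apply: filterS fg => x -> _.
Qed.

Lemma ae_le_Rintegral f g : L1 mu f -> L1 mu g ->
  {ae mu, forall x, f x <= g x} -> \int[mu]_x f x <= \int[mu]_x g x.
Proof.
move=> f1 g1 fg.
have mf := L1_measurable f1; have mg := L1_measurable g1.
(* [le_Rintegral] wants the inequality at every point: [f + |g - f|] agrees with [g] almost
   everywhere and dominates [f] everywhere. *)
rewrite (@ae_eq_Rintegral g (fun x => f x + `|g x - f x|))//.
- apply: le_Rintegral => //; first exact: (L1_add f1 (L1_norm (L1_sub g1 f1))).
  by move=> x _; rewrite lerDl.
- apply: measurable_funD => //; apply: measurableT_comp => //.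
  exact: measurable_funB.
- by apply: filterS fg => x fgx; rewrite ger0_norm ?subr_ge0// addrC subrK.
Qed.

Lemma ae_eq0_Rintegral_norm f : L1 mu f -> \int[mu]_x `|f x| <= 0 ->
  {ae mu, forall x, f x = 0}.
Proof.
move=> f1 f0.
have /ae_eq_integral_abs : measurable_fun setT (EFin \o f).
  exact/measurable_EFinP/L1_measurable.
move=> /(_ mu measurableT)[+ _].
have -> : (\int[mu]_(x in setT) `|(EFin \o f) x| = 0)%E.
  rewrite (L1_integralE (L1_norm f1)); congr EFin; apply/eqP; rewrite eq_le f0/=.
  exact: Rintegral_ge0.
by move=> /(_ erefl); apply: filterS => x /(_ Logic.I) [].
Qed.

Lemma Rintegral_normD f g : L1 mu f -> L1 mu g ->
  \int[mu]_x `|f x + g x| <= \int[mu]_x `|f x| + \int[mu]_x `|g x|.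
Proof.
move=> f1 g1; rewrite -RintegralD//; [|exact: L1_norm..].
apply: le_Rintegral => //; first exact: (L1_norm (L1_add f1 g1)).
- exact: (L1_add (L1_norm f1) (L1_norm g1)).
- by move=> x _; exact: ler_normD.
Qed.

(* Test on the set where [g < f]. *)
Lemma ae_le_of_Rintegral f g : L1 mu f -> L1 mu g ->
  (forall F, measurable F ->
    \int[mu]_x (\1_F x * f x) <= \int[mu]_x (\1_F x * g x)) ->
  {ae mu, forall x, f x <= g x}.
Proof.
move=> f1 g1 fg.
have mf := L1_measurable f1; have mg := L1_measurable g1.
pose F := [set x | g x < f x].
have mF : measurable F.
  have := measurable_fun_ltr mg mf => /(_ measurableT [set true]).
  by rewrite setTI; apply.
have F1 h : L1 mu h -> L1 mu (fun x => \1_F x * h x).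
  by move=> h1; apply: L1_mull => //; exact: Linf_indic.
have := @ae_eq0_Rintegral_norm (fun x => \1_F x * f x - \1_F x * g x).
move=> /(_ (L1_sub (F1 _ f1) (F1 _ g1))).
have -> : \int[mu]_x `|\1_F x * f x - \1_F x * g x| =
    \int[mu]_x (\1_F x * f x - \1_F x * g x).
  apply: eq_Rintegral => x _; rewrite -mulrBr ger0_norm// indicE.
  have [|] := boolP (x \in F); last by rewrite mul0r.
  by rewrite inE /F/= mul1r subr_ge0 => /ltW.
rewrite RintegralB//; [|exact: F1..].
rewrite subr_le0 => /(_ (fg _ mF)); apply: filterS => x.
rewrite -mulrBr indicE; have [/set_mem Fx|nFx _] := boolP (x \in F).
  by rewrite mul1r => /subr0_eq ->.
by rewrite leNgt; apply/negP => gf; move: nFx; rewrite notin_setE; apply.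
Qed.

End L1_basics.

(** * Simple functions *)

Section simple_functions.
Context {d : measure_display} {T : measurableType d} {R : realType}.
Variable mu : {measure set T -> \bar R}.
Implicit Types (f g h s t : T -> R).

Lemma simpleL1_L1 s : simpleL1 mu s -> L1 mu s.
Proof. by case=> _ []. Qed.

Lemma simpleL1_linear (a : R) s t : simpleL1 mu s -> simpleL1 mu t ->
  simpleL1 mu (fun y => a * s y + t y).
Proof.
move=> [ms [fs s1]] [mt [ft t1]]; split; last split; last exact: L1_linear.
  by apply: measurable_funD => //; exact: measurable_funM.
apply: sub_finite_set (finite_image2 (fun u v => a * u + v) fs ft).
by move=> _ [x _ <-]; exists (s x); [exists x|exists (t x) => //; exists x].
Qed.

Lemma simpleL1_norm s : simpleL1 mu s -> simpleL1 mu (fun y => `|s y|).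
Proof.
move=> [ms [fs s1]]; split; first exact: measurableT_comp.
split; last exact: L1_norm.
apply: sub_finite_set (finite_image (fun r => `|r|) fs).
by move=> _ [x _ <-]; exists (s x) => //; exists x.
Qed.

Lemma simpleL1_indic E : measurable E -> (mu E < +oo)%E -> simpleL1 mu (\1_E).
Proof.
move=> mE muE; split => //; split; last exact: L1_indic.
apply: (@sub_finite_set _ _ ([set 0] `|` [set 1])); last first.
  by rewrite finite_setU.
move=> _ [x _ <-]; rewrite indicE; case: (_ \in _); by [right|left].
Qed.

(** A simple function is the sum of [y * \1_(s = y)] over its nonzero values [y]. The value 0 is
    left out because its level set may have infinite measure. *)
Lemma simpleL1_ind (P : (T -> R) -> Prop) :
  (forall E, measurable E -> (mu E < +oo)%E -> P (\1_E)) ->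
  (forall a s t, simpleL1 mu s -> simpleL1 mu t -> P s -> P t ->
    P (fun y => a * s y + t y)) ->
  forall s, simpleL1 mu s -> P s.
Proof.
move=> P1 Plin s simpl_s; have [ms [fs s1]] := simpl_s.
have mlev y : measurable (s @^-1` [set y]).
  by rewrite -[X in measurable X]setTI; apply: ms => //; exact: measurable_set1.
(* Markov's inequality: [|y|] times the measure of the set where [|s| >= |y|] is at most the
   integral of [|s|]. *)
have flev y : y != 0 -> (mu (s @^-1` [set y]) < +oo)%E.
  move=> y0; have y0' : (0 < `|y|) by rewrite normr_gt0.
  have /integrableP[/measurable_EFinP _ sfin] := s1.
  have := @le_integral_abse _ _ _ mu setT measurableT (EFin \o s) `|y|.
  move=> /(_ (measurable_int _ s1) y0') le_s.
  have : (mu (s @^-1` [set y]) <=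
     mu (setT `&` [set x | (`|(EFin \o s) x| >= `|y|%:E)%E]))%E.
    apply: le_measure; rewrite ?inE//.
      apply: emeasurable_fun_c_infty => //; apply: measurableT_comp => //.
      exact: measurable_int s1.
    by move=> x /= ->; split.
  move=> /le_lt_trans; apply.
  have := le_lt_trans le_s sfin; rewrite -lte_pdivlMl// => /lt_le_trans; apply.
  by rewrite leey.
(* Simplicity of the partial sums is carried along because [Plin] asks for it. The empty sum is the
   indicator of the empty set, so [P1] covers the base case. *)
have key (r : seq R) : 0 \notin r ->
    simpleL1 mu (fun x => \sum_(y <- r) y * \1_(s @^-1` [set y]) x) /\
    P (fun x => \sum_(y <- r) y * \1_(s @^-1` [set y]) x).
  have E0 : (fun x : T => \sum_(y <- [::]) y * \1_(s @^-1` [set y]) x) = \1_set0.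
    by apply/funext => x; rewrite big_nil indic0.
  elim: r => [_|y r ih].
    rewrite E0; split; first by apply: simpleL1_indic; rewrite ?measure0.
    by apply: P1; rewrite ?measure0.
  rewrite inE negb_or eq_sym => /andP[y0 /ih[s_r P_r]].
  have -> : (fun x => \sum_(z <- y :: r) z * \1_(s @^-1` [set z]) x) =
    (fun x => y * \1_(s @^-1` [set y]) x +
              \sum_(z <- r) z * \1_(s @^-1` [set z]) x).
    by apply/funext => x; rewrite big_cons.
  have s_y : simpleL1 mu (\1_(s @^-1` [set y])).
    by apply: simpleL1_indic => //; exact: flev.
  split; first exact: simpleL1_linear.
  by apply: Plin => //; apply: P1 => //; exact: flev.
pose r := [seq y <- fset_set (range s) | y != 0].
have [|_] := key r; first by rewrite mem_filter eqxx.
congr P; apply/funext => x.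
have [sx0|sx0] := eqVneq (s x) 0.
  rewrite sx0 big_seq big1// => y; rewrite mem_filter => /andP[y0 _].
  rewrite indicE memNset ?mulr0//= sx0 => /esym/eqP; exact/negP.
have sxr : s x \in r.
  by rewrite mem_filter sx0/= in_fset_set// inE; exists x.
rewrite (bigD1_seq (s x))//=; last exact/filter_uniq/fset_uniq.
rewrite indicE mem_set//= mulr1 big1 ?addr0// => y ysx.
by rewrite indicE memNset ?mulr0//= => sxy; rewrite sxy eqxx in ysx.
Qed.

Import HBSimple.

Lemma simpleL1_dense f (e : R) : L1 mu f -> 0 < e ->
  exists2 s, simpleL1 mu s & \int[mu]_x `|f x - s x| <= e.
Proof.
move=> f1 e0.
have [g [g1 _ gcvg]] := approximation_sfun_integrable measurableT f1.
have sg n : simpleL1 mu (g n).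
  split; first exact: measurable_funP.
  by split; [exact: fimfunP|exact: g1].
move/fine_cvgP : gcvg => [_ /cvgrPdist_le /(_ _ e0)][N _ /(_ N (leqnn N))].
rewrite sub0r normrN => gN; exists (g N) => //.
exact: le_trans (ler_norm _) gN.
Qed.

End simple_functions.

(** * Convergence in L1 *)

Section convergence.
Context {d : measure_display} {T : measurableType d} {R : realType}.
Variable mu : {measure set T -> \bar R}.
Implicit Types (f g h s t : T -> R).

(** The upper limit is measurable and defined everywhere, and it equals the limit wherever that
    exists; [fine] gives a real default to infinite values. *)
Lemma ae_measurable_lim (u : nat -> T -> R) :
  (forall n, measurable_fun setT (u n)) ->
  {ae mu, forall x, cvgn (u ^~ x)} ->
  exists2 g : T -> R, measurable_fun setT g & {ae mu, forall x, u ^~ x @ \oo --> g x}.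
Proof.
move=> mu_ ucvg; exists (fun x => fine (limn_esup (fun n => (u n x)%:E))).
  apply: measurableT_comp => //; apply: measurable_fun_limn_esup => n.
  exact/measurable_EFinP.
apply: filterS ucvg => x ucx.
have /cvg_limn_einf_sup[_ ->]// : (fun n => (u n x)%:E) @ \oo --> (limn (u ^~ x))%:E.
by apply: cvg_EFin => //; exact: nearW.
Qed.

Lemma dominated_cvg_L1 (u : nat -> T -> R) (g B : T -> R) :
  (forall n, measurable_fun setT (u n)) -> measurable_fun setT g -> L1 mu B ->
  {ae mu, forall x, u ^~ x @ \oo --> g x} ->
  {ae mu, forall x n, `|u n x| <= B x} ->
  [/\ L1 mu g, \int[mu]_x `|u n x - g x| @[n --> \oo] --> (0 : R) &
      \int[mu]_x u n x @[n --> \oo] --> \int[mu]_x g x].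
Proof.
move=> mu_ mg B1 ug uB.
have [] := @dominated_convergence _ _ _ mu setT measurableT
  (fun n => EFin \o u n) (EFin \o g) (EFin \o B).
- by move=> n; exact/measurable_EFinP.
- exact/measurable_EFinP.
- apply: filterS ug => x ux _; apply: cvg_EFin => //; exact: nearW.
- by [].
- by apply: filterS uB => x uBx n _; rewrite /= lee_fin.
move=> g1 c0 c1; split => //.
  by move/fine_cvgP : c0 => [].
rewrite L1_integralE// in c1.
by move/fine_cvgP : c1 => [].
Qed.

Lemma ae_bounded_monotone_lim (u : nat -> T -> R) (M : R) :
  (forall n, measurable_fun setT (u n)) ->
  (forall n, {ae mu, forall x, u n x <= u n.+1 x}) ->
  (forall n, {ae mu, forall x, u n x <= M}) ->
  exists2 g : T -> R, measurable_fun setT g & {ae mu, forall x, u ^~ x @ \oo --> g x}.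
Proof.
move=> mu_ /ae_foralln und /ae_foralln uM; apply: ae_measurable_lim => //.
apply: filterS2 und uM => x und uM; apply: nondecreasing_is_cvgn.
  exact/nondecreasing_seqP.
by exists M => _ [n _ <-].
Qed.

(** Riesz-Fischer argument. The sum [G] of the absolute increments has integral at most 1, so it is
    finite almost everywhere. There the telescoping series converges absolutely, and [|u 0| + G] is
    an integrable bound for every term. *)
Lemma L1_complete_fast (u : nat -> T -> R) :
  (forall n, L1 mu (u n)) ->
  (forall n, \int[mu]_x `|u n.+1 x - u n x| <= 1 / (2 ^ n.+1)%:R) ->
  exists2 g : T -> R, L1 mu g & \int[mu]_x `|u n x - g x| @[n --> \oo] --> (0 : R).
Proof.
move=> u1 ufast.
pose G x := (\sum_(n <oo) `|u n.+1 x - u n x|%:E)%E.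
have mdu n : measurable_fun setT (fun x => (`|u n.+1 x - u n x|)%:E).
  apply/measurable_EFinP; apply: measurableT_comp => //.
  by apply: measurable_funB; exact: L1_measurable.
have mG : measurable_fun setT G.
  exact: (@ge0_emeasurable_sum _ _ _ setT _ xpredT).
have G0 x : (0 <= G x)%E by apply: nneseries_ge0 => n _ _; rewrite lee_fin.
have iG : mu.-integrable setT G.
  apply/integrableP; split => //; under eq_integral do rewrite gee0_abs//.
  rewrite integral_nneseries//.
  apply: (@le_lt_trans _ _ (\sum_(n <oo) (1 / (2 ^ n.+1)%:R)%:E)%E).
    apply: lee_nneseries => [i _ _|i _]; first by apply: integral_ge0 => x _; rewrite lee_fin.
    by rewrite L1_integralE ?lee_fin//; exact: (L1_norm (L1_sub (u1 _) (u1 _))).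
  by apply: le_lt_trans (epsilon_trick0 xpredT _) _ => //; rewrite ltry.
have partial x k : (\sum_(0 <= i < k) `|u i.+1 x - u i x|%:E <= G x)%E.
  by apply: nneseries_lim_ge => n _ _; rewrite lee_fin.
have Gfin : {ae mu, forall x, G x \is a fin_num}.
  by apply: filterS (integrable_ae measurableT iG) => x; apply.
have partial' : {ae mu, forall x,
    forall k, \sum_(0 <= i < k) `|u i.+1 x - u i x| <= fine (G x)}.
  by apply: filterS Gfin => x Gx k; rewrite -lee_fin fineK// -sumEFin.
have [g mg ug] : exists2 g : T -> R, measurable_fun setT g &
    {ae mu, forall x, u ^~ x @ \oo --> g x}.
  apply: ae_measurable_lim; first by move=> n; exact: L1_measurable.
  apply: filterS partial' => x Gx.
  rewrite (_ : u ^~ x = (fun n => series (telescope (u ^~ x)) n + u 0%N x)); last first.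
    by apply/funext => n; rewrite telescopeK/= subrK.
  apply: is_cvgD; last exact: is_cvg_cst.
  apply: normed_cvg; apply: nondecreasing_is_cvgn.
    by apply: nondecreasing_series => i _ _; exact: normr_ge0.
  by exists (fine (G x)) => _ [n _ <-]; exact: Gx.
have GB : L1 mu (fun x => `|u 0%N x| + fine (G x)).
  apply: L1_add; first exact: L1_norm.
  apply: (@eq_integrable _ _ _ _ _ measurableT (EFin \o (fun x => fine (G x)))) => //.
  apply/integrableP; split.
    by apply/measurable_EFinP; exact: measurableT_comp.
  move/integrableP : (iG) => [_]; apply: le_lt_trans.
  apply: ge0_le_integral => //.
  - by do 3 apply: measurableT_comp => //.
  - exact: measurableT_comp.
  - by move=> x _ /=; case: (G x) => [r| |]//=; rewrite ?normr0 leey.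
have [||g1 ug0 _] := dominated_cvg_L1 (u := u) _ mg GB ug.
- by move=> n; exact: L1_measurable.
- apply: filterS partial' => x Gx n.
  rewrite -[u n x](subrK (u 0%N x)) addrC (le_trans (ler_normD _ _))// lerD2l.
  rewrite -(telescope_sumr (u ^~ x))//.
  by rewrite (le_trans (ler_norm_sum _ _ _)).
by exists g.
Qed.

End convergence.

(** * Markov operators and the extension of [D] *)

Section positive_operators.
Context {d : measure_display} {T : measurableType d} {R : realType}.
Variable mu : {measure set T -> \bar R}.
Implicit Types (f g h s t : T -> R).

Lemma Rintegral_indic E : measurable E -> \int[mu]_x \1_E x = fine (mu E).
Proof. by move=> mE; rewrite /Rintegral integral_indic// setIT. Qed.

(** For [a] equal to 1 or -1, [a * f + |f|] is nonnegative, so positivity gives [|U f| <= U |f|];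
    integrating concludes. The class [C] is abstract so that the lemma serves both Markov operators
    on L^1 and [D] on simple functions. *)
Lemma positive_contraction (C : (T -> R) -> Prop) (U : (T -> R) -> T -> R) :
  (forall f, C f -> L1 mu f) ->
  (forall a f g, C f -> C g -> C (fun y => a * f y + g y)) ->
  (forall f, C f -> C (fun y => `|f y|)) ->
  (forall f, C f -> L1 mu (U f)) ->
  (forall a f g, C f -> C g ->
    {ae mu, forall x, U (fun y => a * f y + g y) x = a * U f x + U g x}) ->
  (forall f, C f -> {ae mu, forall x, 0 <= f x} ->
    {ae mu, forall x, 0 <= U f x}) ->
  (forall f, C f -> \int[mu]_x U f x = \int[mu]_x f x) ->
  forall f, C f -> \int[mu]_x `|U f x| <= \int[mu]_x `|f x|.
Proof.
move=> CL1 Clin Cnorm UL1 Ulin U0 Uint f Cf.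
have Cnf := Cnorm _ Cf.
rewrite -(Uint _ Cnf); apply: ae_le_Rintegral; [exact/L1_norm/UL1|exact: UL1|].
have pos a : `|a| = 1 -> {ae mu, forall x, 0 <= a * U f x + U (fun y => `|f y|) x}.
  move=> a1; have : {ae mu, forall x, 0 <= a * f x + `|f x|}.
    apply: aeW => x; rewrite -[X in _ + X]mul1r -a1 -normrM.
    by rewrite -lerBlDl sub0r (le_trans (ler_norm _))// normrN.
  by move=> /(U0 _ (Clin a _ _ Cf Cnf)); apply: filterS2 (Ulin a _ _ Cf Cnf) => x ->.
apply: filterS2 (pos 1 (normr1 R)) (pos (-1) (normrN1 R)) => x p1 p2.
by rewrite ler_norml; apply/andP; split; lra.
Qed.

Lemma Rintegral_norm_linear (a : R) f g : L1 mu f -> L1 mu g ->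
  \int[mu]_x `|a * f x + g x| <= `|a| * \int[mu]_x `|f x| + \int[mu]_x `|g x|.
Proof.
move=> f1 g1; rewrite (le_trans (Rintegral_normD (L1_scale a f1) g1))// lerD2r.
under eq_Rintegral do rewrite normrM.
by rewrite RintegralZl//; exact: L1_norm.
Qed.

Lemma Rintegral_norm_sym f g :
  \int[mu]_x `|f x - g x| = \int[mu]_x `|g x - f x|.
Proof. by apply: eq_Rintegral => x _; rewrite distrC. Qed.

Lemma Rintegral_norm_triangle f g h : L1 mu f -> L1 mu g -> L1 mu h ->
  \int[mu]_x `|f x - h x| <=
  \int[mu]_x `|f x - g x| + \int[mu]_x `|g x - h x|.
Proof.
move=> f1 g1 h1; rewrite (le_trans _ (Rintegral_normD (L1_sub f1 g1) (L1_sub g1 h1)))//.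
by under [leRHS]eq_Rintegral do rewrite addrA subrK.
Qed.

Section markov.
Variable Top : (T -> R) -> T -> R.
Hypothesis mTop : markov_op mu Top.

Lemma markov_L1 f : L1 mu f -> L1 mu (Top f).
Proof. by case: mTop => -[+ _] _; exact. Qed.

Lemma markov_ge0 f : L1 mu f -> {ae mu, forall x, 0 <= f x} ->
  {ae mu, forall x, 0 <= Top f x}.
Proof. by case: mTop => _ [+ _]; exact. Qed.

Lemma markov_linear a f g : L1 mu f -> L1 mu g ->
  {ae mu, forall x, Top (fun y => a * f y + g y) x = a * Top f x + Top g x}.
Proof. by case: mTop => -[_ [_ +]] _; exact. Qed.

Lemma markov_Rintegral f : L1 mu f -> \int[mu]_x Top f x = \int[mu]_x f x.
Proof. by move=> f1; case: mTop => _ [_ /(_ _ f1)]; rewrite /Rintegral => ->. Qed.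

Lemma markov_sub f g : L1 mu f -> L1 mu g ->
  {ae mu, forall x, Top (fun y => f y - g y) x = Top f x - Top g x}.
Proof.
move=> f1 g1; apply: filterS (markov_linear (-1) g1 f1) => x.
rewrite (_ : (fun y => -1 * g y + f y) = (fun y => f y - g y)); last first.
  by apply/funext => y; ring.
by move=> ->; ring.
Qed.

Lemma markov_le f g : L1 mu f -> L1 mu g -> {ae mu, forall x, f x <= g x} ->
  {ae mu, forall x, Top f x <= Top g x}.
Proof.
move=> f1 g1 fg.
have /(markov_ge0 (L1_sub g1 f1)) : {ae mu, forall x, 0 <= g x - f x}.
  by apply: filterS fg => x; rewrite subr_ge0.
by apply: filterS2 (markov_sub g1 f1) => x ->; rewrite subr_ge0.
Qed.

Lemma markov_contraction f : L1 mu f ->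
  \int[mu]_x `|Top f x| <= \int[mu]_x `|f x|.
Proof.
apply: positive_contraction => //.
- exact: L1_linear.
- exact: L1_norm.
- exact: markov_L1.
- exact: markov_linear.
- exact: markov_ge0.
- exact: markov_Rintegral.
Qed.

End markov.

(** * Extension by density of a positive, integral-preserving map on simple functions *)

Section extension.
Variable D : (T -> R) -> T -> R.
Hypothesis Dlin : simple_linear_map mu D.
Hypothesis D0 : nonneg_map mu D.
Hypothesis D1 : forall E, measurable E -> (mu E < +oo)%E ->
  (\int[mu]_x (D (\1_E) x)%:E = mu E)%E.

Let DL1 s : simpleL1 mu s -> L1 mu (D s).
Proof. by case: Dlin => + _; exact. Qed.

Let Dlinear a s t : simpleL1 mu s -> simpleL1 mu t ->
  {ae mu, forall x, D (fun y => a * s y + t y) x = a * D s x + D t x}.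
Proof. by case: Dlin => _ [_ +]; exact. Qed.

Lemma simple_map_Rintegral s : simpleL1 mu s ->
  \int[mu]_x D s x = \int[mu]_x s x.
Proof.
move: s; apply: simpleL1_ind => [E mE muE|a s t s1 t1 Ds Dt].
  by rewrite Rintegral_indic// /Rintegral D1.
rewrite Rintegral_linear; [|exact: simpleL1_L1..]; rewrite -Ds -Dt.
rewrite -Rintegral_linear; [|exact: DL1..].
apply: ae_eq_Rintegral; last exact: Dlinear.
- exact/L1_measurable/DL1/simpleL1_linear.
- exact/L1_measurable/L1_linear/DL1/t1/DL1/s1.
Qed.

Lemma simple_map_contraction s : simpleL1 mu s ->
  \int[mu]_x `|D s x| <= \int[mu]_x `|s x|.
Proof.
apply: positive_contraction => //.
- exact: simpleL1_L1.
- exact: simpleL1_linear.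
- exact: simpleL1_norm.
- exact: simple_map_Rintegral.
Qed.

Let simple_sub s t : simpleL1 mu s -> simpleL1 mu t ->
  simpleL1 mu (fun y => s y - t y).
Proof.
move=> s1 t1; have := simpleL1_linear (-1) t1 s1.
by congr simpleL1; apply/funext => y; ring.
Qed.

Lemma simple_map_contractionB s t : simpleL1 mu s -> simpleL1 mu t ->
  \int[mu]_x `|D s x - D t x| <= \int[mu]_x `|s x - t x|.
Proof.
move=> s1 t1; have := simple_map_contraction (simple_sub s1 t1).
apply: le_trans; rewrite le_eqVlt; apply/orP; left; apply/eqP.
have st_E : (fun y => s y - t y) = (fun y => -1 * t y + s y).
  by apply/funext => y; ring.
apply: ae_eq_Rintegral.
- exact/L1_measurable/L1_norm/L1_sub/DL1/t1/DL1/s1.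
- exact/L1_measurable/L1_norm/DL1/simple_sub.
- rewrite st_E; apply: filterS (Dlinear (-1) t1 s1) => x ->.
  by congr (`| _ |); ring.
Qed.

(* [g] is the value at [f] of the continuous extension of [D]. *)
Definition ext_value f g := L1 mu g /\ forall e : R, 0 < e ->
  exists s, [/\ simpleL1 mu s, \int[mu]_x `|f x - s x| <= e &
                \int[mu]_x `|g x - D s x| <= e].

Lemma ext_value_simple s : simpleL1 mu s -> ext_value s (D s).
Proof.
move=> s1; split; first exact: DL1.
move=> e e0; exists s; split => //; under eq_Rintegral do rewrite subrr normr0.
  by rewrite Rintegral_cst// mul0r ltW.
by rewrite Rintegral_cst// mul0r ltW.
Qed.

Lemma ext_value_exists f : L1 mu f -> exists g, ext_value f g.
Proof.
move=> f1.
(* The exponent [n.+2] leaves room for the triangle inequality through [f]: 2^-(n+3) + 2^-(n+2) is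
   below 2^-(n+1), the rate required by [L1_complete_fast]. *)
have e0 n : (0 : R) < 1 / (2 ^ n.+2)%:R by rewrite divr_gt0// ltr0n expn_gt0.
have /choice[s sP] : forall n, exists s : T -> R,
    simpleL1 mu s /\ \int[mu]_x `|f x - s x| <= 1 / (2 ^ n.+2)%:R.
  by move=> n; have [s] := simpleL1_dense f1 (e0 n); exists s.
have s1 n : simpleL1 mu (s n) by have [] := sP n.
have [|n|g g1 gcvg] := @L1_complete_fast _ _ _ mu (fun n => D (s n)).
- by move=> n; exact: DL1.
- rewrite (le_trans (simple_map_contractionB (s1 _) (s1 _)))//.
  rewrite (le_trans (Rintegral_norm_triangle (simpleL1_L1 (s1 _)) f1
    (simpleL1_L1 (s1 _))))//.
  rewrite Rintegral_norm_sym (le_trans (lerD (sP n.+1).2 (sP n).2))//.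
  have -> : 1 / (2 ^ n.+3)%:R = (1 / (2 ^ n.+2)%:R) / 2 :> R.
    by rewrite [(2 ^ n.+3)%N]expnS natrM invfM; ring.
  have -> : 1 / (2 ^ n.+1)%:R = (1 / (2 ^ n.+2)%:R) * 2 :> R.
    rewrite [(2 ^ n.+2)%N]expnS natrM invfM; field.
    by rewrite pnatr_eq0 expn_eq0.
  by have := e0 n; lra.
exists g; split => // e e_gt0.
have /cvgrPdist_le/(_ _ e_gt0)[N _ gN] := gcvg.
have /cvgrPdist_le/(_ _ e_gt0)[M _ fM] :
    (1 / (2 ^ n.+2)%:R : R) @[n --> \oo] --> (0 : R).
  rewrite (_ : (fun _ => _) = geometric (1 / 4) (1 / 2)); last first.
    apply/funext => n /=; rewrite !expnS !natrM natrX !invfM expr_div_n expr1n.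
    by field; rewrite expf_neq0.
  by apply: cvg_geometric; rewrite ger0_norm; lra.
(* [N] controls the distance from [D (s n)] to [g], and [M] the distance from [s n] to [f]. *)
exists (s (maxn N M)); split => //.
  have /= := fM _ (leq_maxr N M); rewrite sub0r normrN => /(le_trans (ler_norm _)).
  exact: le_trans (sP _).2.
have /= := gN _ (leq_maxl N M); rewrite sub0r normrN => /(le_trans (ler_norm _)).
by rewrite Rintegral_norm_sym.
Qed.

Lemma ext_value_linear a f g f' g' : L1 mu f -> L1 mu f' ->
  ext_value f g -> ext_value f' g' ->
  ext_value (fun y => a * f y + f' y) (fun y => a * g y + g' y).
Proof.
move=> f1 f1' [g1 fg] [g1' fg']; split; first exact: L1_linear.
(* With tolerance [e / (|a| + 1)] for both functions the combination has error at most [e]; adding 1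
   keeps the denominator positive when [a = 0]. *)
move=> e e0; have a0 : 0 < `|a| + 1 by rewrite ltr_wpDl.
have e1 := divr_gt0 e0 a0.
have eE : `|a| * (e / (`|a| + 1)) + e / (`|a| + 1) = e.
  by field; rewrite gt_eqF//; lra.
have [s [s1 fs gs]] := fg _ e1; have [s' [s1' fs' gs']] := fg' _ e1.
exists (fun y => a * s y + s' y); split; first exact: simpleL1_linear.
  under eq_Rintegral => x _.
    rewrite (_ : _ - _ = a * (f x - s x) + (f' x - s' x)); last by ring.
    over.
  rewrite (le_trans (Rintegral_norm_linear _ _ _))//.
  - by apply: L1_sub => //; exact: simpleL1_L1.
  - by apply: L1_sub => //; exact: simpleL1_L1.
  - by rewrite -eE lerD// ler_wpM2l.
rewrite (@ae_eq_Rintegral _ _ _ _ _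
  (fun x => `|a * (g x - D s x) + (g' x - D s' x)|)).
- rewrite (le_trans (Rintegral_norm_linear _ _ _))//.
  + by apply: L1_sub => //; exact: DL1.
  + by apply: L1_sub => //; exact: DL1.
  + by rewrite -eE lerD// ler_wpM2l.
- exact: (L1_measurable (L1_norm (L1_sub (L1_linear a g1 g1')
    (DL1 (simpleL1_linear a s1 s1'))))).
- exact: (L1_measurable (L1_norm (L1_linear a (L1_sub g1 (DL1 s1))
    (L1_sub g1' (DL1 s1'))))).
- apply: filterS (Dlinear a s1 s1') => x ->; congr (`| _ |); ring.
Qed.

Lemma ext_value_norm f g : L1 mu f -> ext_value f g ->
  \int[mu]_x `|g x| <= \int[mu]_x `|f x|.
Proof.
move=> f1 [g1 fg]; apply: ler_addgt0_twice => e /fg[s [s1 fs gs]].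
have sL1 := simpleL1_L1 s1; have Ds1 := DL1 s1.
have g_le : \int[mu]_x `|g x| <= \int[mu]_x `|g x - D s x| + \int[mu]_x `|D s x|.
  rewrite (le_trans _ (Rintegral_normD (L1_sub g1 Ds1) Ds1))//.
  by under [leRHS]eq_Rintegral do rewrite subrK.
have s_le : \int[mu]_x `|s x| <= \int[mu]_x `|s x - f x| + \int[mu]_x `|f x|.
  rewrite (le_trans _ (Rintegral_normD (L1_sub sL1 f1) f1))//.
  by under [leRHS]eq_Rintegral do rewrite subrK.
have := simple_map_contraction s1; rewrite Rintegral_norm_sym in fs; lra.
Qed.

(** By linearity [g - g'] is a value at [f - f'], a function of norm 0, so [ext_value_norm] makes it
    vanish. Allowing two arguments equal almost everywhere gives compatibility with null sets as
    well as uniqueness. *)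
Lemma ext_value_unique f g f' g' : L1 mu f -> L1 mu f' ->
  ext_value f g -> ext_value f' g' ->
  {ae mu, forall x, f x = f' x} -> {ae mu, forall x, g x = g' x}.
Proof.
move=> f1 f1' fg fg' ff'.
have gg' := ext_value_linear (-1) f1' f1 fg' fg.
have := ext_value_norm (L1_linear (-1) f1' f1) gg'.
rewrite (@ae_eq_Rintegral _ _ _ _ (fun x => `|-1 * f' x + f x|) (cst 0))//.
- rewrite Rintegral_cst// mul0r => /ae_eq0_Rintegral_norm; case: gg' => gg' _.
  by move=> /(_ gg'); apply: filterS => x gg'x; apply/eqP; rewrite -subr_eq0 -gg'x; apply/eqP; ring.
- exact: (L1_measurable (L1_norm (L1_linear (-1) f1' f1))).
- by apply: filterS ff' => x ->; rewrite /= mulN1r addNr normr0.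
Qed.

Lemma ext_value_Rintegral f g : L1 mu f -> ext_value f g ->
  \int[mu]_x g x = \int[mu]_x f x.
Proof.
move=> f1 [g1 fg].
suff : `|\int[mu]_x g x - \int[mu]_x f x| <= 0.
  by rewrite normr_le0 subr_eq0 => /eqP.
apply: ler_addgt0_twice => e /fg[s [s1 fs gs]].
have sL1 := simpleL1_L1 s1; have Ds1 := DL1 s1.
have := le_normr_Rintegral measurableT (L1_sub g1 Ds1).
have := le_normr_Rintegral measurableT (L1_sub f1 sL1).
rewrite !RintegralB// simple_map_Rintegral// !ler_norml => /andP[? ?] /andP[? ?].
by apply/andP; split; lra.
Qed.

(* [g] has the integral of [f] and at most the norm of [f], so [|g| - g] has
   integral at most [0]. *)
Lemma ext_value_ge0 f g : L1 mu f -> ext_value f g ->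
  {ae mu, forall x, 0 <= f x} -> {ae mu, forall x, 0 <= g x}.
Proof.
move=> f1 fg f0; have [g1 _] := fg.
have : \int[mu]_x `| `|g x| - g x| <= 0.
  under eq_Rintegral do rewrite ger0_norm ?subr_ge0 ?ler_norm//.
  rewrite RintegralB//; last exact: L1_norm.
  rewrite (ext_value_Rintegral f1 fg) subr_le0.
  rewrite (le_trans (ext_value_norm f1 fg))// le_eqVlt; apply/orP; left; apply/eqP.
  apply: ae_eq_Rintegral; [exact: L1_measurable (L1_norm f1)|exact: L1_measurable f1|].
  by apply: filterS f0 => x f0; rewrite ger0_norm.
move=> /(ae_eq0_Rintegral_norm (L1_sub (L1_norm g1) g1)); apply: filterS => x.
by move=> /subr0_eq <-.
Qed.

Lemma markov_extension : exists2 Top, markov_op mu Top &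
  extends mu Top D /\ forall Top', markov_op mu Top' -> extends mu Top' D ->
    forall f, L1 mu f -> {ae mu, forall x, Top' f x = Top f x}.
Proof.
have /choice[Top TopP] : forall f, exists g, L1 mu f -> ext_value f g.
  (* Outside L^1 nothing is required, and [f] itself is a dummy value. *)
  move=> f; have [f1|nf1] := pselect (L1 mu f); last by exists f.
  by have [g fg] := ext_value_exists f1; exists g.
have L1Top f : L1 mu f -> L1 mu (Top f) by move=> /TopP[].
exists Top; [split; [split => //; split|split]|split].
- move=> f g f1 g1 fg.
  exact: (ext_value_unique f1 g1 (TopP _ f1) (TopP _ g1)).
- move=> a f g f1 g1; have fg1 := L1_linear a f1 g1.
  apply: (ext_value_unique fg1 fg1 (TopP _ fg1)).
    exact: (ext_value_linear a f1 g1 (TopP _ f1) (TopP _ g1)).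
  exact: aeW.
- by move=> f f1; exact: (ext_value_ge0 f1 (TopP _ f1)).
- move=> f f1; rewrite !L1_integralE//; last exact: L1Top.
  by rewrite (ext_value_Rintegral f1 (TopP _ f1)).
- move=> s s1; have sL1 := simpleL1_L1 s1.
  apply: (ext_value_unique sL1 sL1 (TopP _ sL1) (ext_value_simple s1)).
  exact: aeW.
(* A Markov operator is a contraction, so if it agrees with [D] on simple functions then [Top' f] is
   itself a value at [f] in the sense of [ext_value]. *)
- move=> Top' mTop' eTop' f f1.
  apply: (ext_value_unique f1 f1 _ (TopP _ f1)); last exact: aeW.
  split; first exact: (markov_L1 mTop').
  move=> e /(simpleL1_dense f1)[s s1 fs]; exists s; split => //.
  have sL1 := simpleL1_L1 s1.
  rewrite (le_trans _ fs)// (le_trans _ (markov_contraction mTop' (L1_sub f1 sL1)))//.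
  rewrite le_eqVlt; apply/orP; left; apply/eqP.
  apply: ae_eq_Rintegral.
  + exact/L1_measurable/L1_norm/L1_sub/DL1/s1/(markov_L1 mTop').
  + exact/L1_measurable/L1_norm/(markov_L1 mTop')/L1_sub.
  + by apply: filterS2 (markov_sub mTop' f1 sL1) (eTop' _ s1) => x -> ->.
Qed.

End extension.

End positive_operators.

(** * The dual of L1 *)

Section dual_representation.
Context {d : measure_display} {T : measurableType d} {R : realType}.
Variable mu : {measure set T -> \bar R}.
Implicit Types (f g h s t : T -> R).

(** A real-valued [nu] is automatically a finite charge, which makes its density integrable. The
    measure and [nu] are repacked as structures so that the Radon-Nikodym derivative can be
    formed. *)
Lemma radon_nikodym_L1 (nu : set T -> R) : sigma_finite setT mu ->
  nu set0 = 0 -> semi_sigma_additive (EFin \o nu) ->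
  (forall F, measurable F -> mu F = 0%E -> nu F = 0) ->
  exists2 k : T -> R, L1 mu k &
    forall F, measurable F -> nu F = \int[mu]_x (\1_F x * k x).
Proof.
move=> sf nu0 nuS numu.
have [mu' muE] : exists mu' : {sigma_finite_measure set T -> \bar R},
    mu' = mu :> {measure set T -> \bar R}.
  pose mu' : {sigma_finite_measure set T -> \bar R} :=
    HB.pack (Measure.sort mu) (Measure.class mu)
      (isSFinite.Build _ _ _ (Measure.sort mu) (sfinite_measure_sigma_finite sf))
      (isSigmaFinite.Build _ _ _ (Measure.sort mu) sf).
  by exists mu'; exact: eq_measure.
have nu0' : (EFin \o nu) set0 = 0%E by rewrite /= nu0.
pose nu' : {charge set T -> \bar R} := HB.pack (EFin \o nu)
  (isCharge.Build _ _ _ (EFin \o nu) nu0' (fun x _ => isT) nuS).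
have dom : nu' `<< mu'.
  by apply/null_content_dominatesP => F mF F0; rewrite /= numu// -F0 -muE.
have [k [kfin k1 kint]] : exists k : T -> \bar R, [/\ forall x, k x \is a fin_num,
    mu.-integrable setT k &
    forall F, measurable F -> (nu F)%:E = (\int[mu]_(x in F) k x)%E].
  rewrite -muE; exists (Radon_Nikodym nu' mu'); split.
  - by move=> x; exact: Radon_Nikodym_fin_num.
  - exact: Radon_Nikodym_integrable.
  - by move=> F mF; rewrite -Radon_Nikodym_integral.
exists (fine \o k).
  by apply: eq_integrable k1 => // x _; rewrite /= fineK.
move=> F mF; have /= := kint F mF; rewrite integral_mkcond.
rewrite (eq_integral (fun x => (\1_F x * fine (k x))%:E)); last first.
  by move=> x _; rewrite epatch_indic EFinM fineK// muleC.
by move=> /(congr1 fine).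
Qed.

Variable A : nat -> set T.
Hypothesis sf : sigma_finite setT mu.
Hypothesis mA : forall n, measurable (A n).
Hypothesis fA : forall n, (mu (A n) < +oo)%E.
Hypothesis ndA : forall n, A n `<=` A n.+1.
Hypothesis UA : \bigcup_n A n = setT.

Lemma exhaustion_nondecreasing m n x : (m <= n)%N -> A m x -> A n x.
Proof.
move=> /subnK <-; elim: (n - m)%N => [//|k ih] Ax.
by rewrite addSn; exact/ndA/ih.
Qed.

Lemma cvg_indic_exhaustion x : \1_(A n) x @[n --> \oo] --> (1 : R).
Proof.
have [m _ Am] : (\bigcup_n A n) x by rewrite UA.
apply: cvg_near_cst; exists m => // n /= mn.
by rewrite indicE mem_set//; exact: exhaustion_nondecreasing Am.
Qed.

Lemma measure_exhaustion_lty F n : measurable F -> (mu (F `&` A n) < +oo)%E.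
Proof.
move=> mF; apply: le_lt_trans (fA n).
by apply: le_measure; rewrite ?inE//; exact: measurableI.
Qed.

Variable L : (T -> R) -> R.
Hypothesis Llin : forall a f g, L1 mu f -> L1 mu g ->
  L (fun y => a * f y + g y) = a * L f + L g.
Hypothesis L0 : forall f, L1 mu f -> {ae mu, forall x, 0 <= f x} ->
  0 <= L f <= \int[mu]_x f x.

Let LB f g : L1 mu f -> L1 mu g -> L (fun y => f y - g y) = L f - L g.
Proof.
move=> f1 g1; rewrite -[RHS]addrC -mulN1r -Llin//.
by congr L; apply/funext => y; ring.
Qed.

Let Lcst0 : L (cst 0) = 0.
Proof.
have c0 : L1 mu (cst 0) by exact: integrable0.
have := LB c0 c0; rewrite subrr => L00; rewrite -[RHS]L00; congr L.
by apply/funext => x; rewrite /= subrr.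
Qed.

Let LD f g : L1 mu f -> L1 mu g -> L (fun y => f y + g y) = L f + L g.
Proof.
move=> f1 g1; rewrite -[L f]mul1r -Llin//.
by congr L; apply/funext => y; ring.
Qed.

Let Lnorm f : L1 mu f -> `|L f| <= \int[mu]_x `|f x|.
Proof.
move=> f1; have nf1 := L1_norm f1.
have /andP[_ ub] := L0 nf1 (aeW mu (fun x => normr_ge0 (f x))).
have : 0 <= L (fun y => 1 * f y + `|f y|).
  apply: (andP (L0 (L1_linear 1 f1 nf1) _)).1; apply: aeW => x.
  by have := ler_norm (- f x); rewrite normrN; lra.
have : 0 <= L (fun y => -1 * f y + `|f y|).
  apply: (andP (L0 (L1_linear (-1) f1 nf1) _)).1; apply: aeW => x.
  by have := ler_norm (f x); lra.
rewrite !Llin// ler_norml => ? ?; apply/andP; split; lra.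
Qed.

Let Lcvg (u : nat -> T -> R) f : (forall n, L1 mu (u n)) -> L1 mu f ->
  \int[mu]_x `|u n x - f x| @[n --> \oo] --> (0 : R) ->
  L (u n) @[n --> \oo] --> L f.
Proof.
move=> u1 f1 /cvgrPdist_le uf; apply/cvgrPdist_le => e /uf; apply: filterS => n.
rewrite sub0r normrN distrC -LB// => h.
by rewrite (le_trans (Lnorm _))//; [exact: L1_sub|exact: le_trans (ler_norm _) h].
Qed.

(** The cut by [A n] keeps the indicator integrable for every measurable [F], so [L] is applied only
    where it is controlled. *)
Let nu n F := L (\1_(F `&` A n)).

(** The partial sums are the values of [nu n] at the finite unions [V k]. Their indicators, cut by
    [A n], converge in L^1 under the bound [\1_(A n)], and [L] is continuous for that norm. *)
Let nu_sigma_additive n : semi_sigma_additive (EFin \o nu n).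
Proof.
move=> F mF tF mUF.
pose V k := \bigcup_(i in `I_k) F i.
have mV k : measurable (V k) by apply: bigcup_measurable.
have I1 G : measurable G -> L1 mu (\1_(G `&` A n)).
  move=> mG; apply: L1_indic; first exact: measurableI.
  exact: measure_exhaustion_lty.
have V0 : V 0%N = set0 by rewrite /V II0 bigcup_set0.
have VS k : V k.+1 = V k `|` F k.
  by rewrite /V IIS bigcup_setU bigcup_set1.
have Vnu k : \sum_(0 <= i < k) nu n (F i) = nu n (V k).
  elim: k => [|k ih].
    rewrite big_nil V0 /nu set0I indic0.
    by rewrite Lcst0.
  rewrite big_nat_recr//= ih -LD; [|exact: I1..].
  congr L; apply/funext => x; rewrite VS setIUl !indicE in_setU.
  have [VAx|_] := boolP (x \in V k `&` A n); last by rewrite add0r.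
  rewrite memNset ?addr0// => -[Fkx _].
  move/set_mem : VAx => [[i /= ik Fix] _].
  have ik' : i = k by apply: tF => //; exists x.
  by rewrite ik' ltnn in ik.
rewrite (_ : (fun k => _) = EFin \o (fun k => nu n (V k))); last first.
  by apply/funext => k /=; rewrite -Vnu sumEFin.
apply: cvg_EFin; first exact: nearW.
apply: Lcvg => [k||]; [exact: I1|exact: I1|].
have [//|||||] := @dominated_cvg_L1 _ _ _ mu (fun k => \1_(V k `&` A n))
  (\1_(\bigcup_k F k `&` A n)) (\1_(A n)).
- by move=> k; exact: L1_measurable (I1 _ (mV k)).
- exact: L1_measurable (I1 _ mUF).
- exact: L1_indic.
- apply: aeW => x; have [[[i _ Fix] Ax]|nx] := pselect ((\bigcup_k F k `&` A n) x).
    apply: cvg_near_cst; exists i.+1 => // k /= ik.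
    by rewrite !indicE !mem_set//; split => //; exists i.
  apply: cvg_near_cst; exists 0%N => // k _ /=.
  rewrite !indicE !memNset// => -[[i /= _ Fix] Ax].
  by apply: nx; split => //; exists i.
- apply: aeW => x k; rewrite !indicE ger0_norm// ler_nat.
  have [/set_mem[_ Ax]|//] := boolP (x \in V k `&` A n).
  by rewrite mem_set.
- by [].
Qed.

(** The density [k n] of [nu n] lies between 0 and [\1_(A n)], because [0 <= L f <= int f] for
    [f >= 0], and it increases with [n]. Its limit [h] thus has values in [0, 1]; it represents [L]
    on indicators, then on simple functions, then on L^1 by density. *)
Lemma L1_dual_representation : exists h, [/\ Linf mu h,
  {ae mu, forall x, 0 <= h x} &
  forall f, L1 mu f -> L f = \int[mu]_x (h x * f x)].
Proof.
have I1 n G : measurable G -> L1 mu (\1_(G `&` A n)).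
  move=> mG; apply: L1_indic; first exact: measurableI.
  exact: measure_exhaustion_lty.
have Lindic F : measurable F -> (mu F < +oo)%E -> 0 <= L \1_F <= \int[mu]_x \1_F x.
  by move=> mF muF; apply: L0; [exact: L1_indic|exact: aeW].
have /choice[k kP] : forall n, exists k, L1 mu k /\
    forall F, measurable F -> nu n F = \int[mu]_x (\1_F x * k x).
  move=> n.
  have [||k k1 kint] := @radon_nikodym_L1 (nu n) sf _ (@nu_sigma_additive n).
  - by rewrite /nu set0I indic0 Lcst0.
  - move=> F mF F0; have := Lindic _ (measurableI _ _ mF (mA n)).
    move=> /(_ (measure_exhaustion_lty _ mF)).
    rewrite Rintegral_indic//; last exact: measurableI.
    rewrite (_ : mu (F `&` A n) = 0%E) /=; last first.
      by apply/eqP; rewrite -measure_le0 -F0; apply: le_measure => //;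
        rewrite ?inE//; exact: measurableI.
    by move=> /andP[? ?]; apply/eqP; rewrite eq_le; apply/andP.
  - by exists k.
have k1 n : L1 mu (k n) by have [] := kP n.
have kint n F : measurable F -> nu n F = \int[mu]_x (\1_F x * k n x).
  by have [_] := kP n; exact.
have k0 n : {ae mu, forall x, 0 <= k n x}.
  have c0 : L1 mu (cst 0) by exact: integrable0.
  apply: (ae_le_of_Rintegral c0 (k1 n)) => F mF; rewrite -kint//.
  under eq_Rintegral do rewrite mulr0.
  rewrite Rintegral_cst// mul0r.
  by have /andP[] := Lindic _ (measurableI _ _ mF (mA n)) (measure_exhaustion_lty _ mF).
have kA n : {ae mu, forall x, k n x <= \1_(A n) x}.
  apply: (ae_le_of_Rintegral (k1 n)); first exact: L1_indic.
  move=> F mF; rewrite -kint//.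
  have /andP[_] := Lindic _ (measurableI _ _ mF (mA n)) (measure_exhaustion_lty _ mF).
  by rewrite /nu indicI.
have knd n : {ae mu, forall x, k n x <= k n.+1 x}.
  apply: (ae_le_of_Rintegral (k1 n) (k1 n.+1)) => F mF; rewrite -!kint//.
  rewrite -subr_ge0 -LB; [|exact: I1..].
  have II : L1 mu (fun y => \1_(F `&` A n.+1) y - \1_(F `&` A n) y).
    by apply: L1_sub; exact: I1.
  suff /(L0 II)/andP[] :
    {ae mu, forall x, 0 <= \1_(F `&` A n.+1) x - \1_(F `&` A n) x :> R} by [].
  apply: aeW => x; rewrite subr_ge0 !indicE ler_nat.
  have [/set_mem[Fx Ax]|//] := boolP (x \in F `&` A n).
  by rewrite mem_set//; split => //; exact: ndA.
have kle1 n : {ae mu, forall x, k n x <= 1}.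
  by apply: filterS (kA n) => x /le_trans; apply; rewrite indicE lern1; case: (_ \in _).
have [h mh kh] := ae_bounded_monotone_lim (fun n => L1_measurable (k1 n)) knd kle1.
have h01 : {ae mu, forall x, 0 <= h x <= 1}.
  apply: filterS3 kh (ae_foralln k0) (ae_foralln kle1) => x kh k0x kle1x.
  apply/andP; split.
    by apply: (cvgr_to_ge kh); exact: nearW.
  by apply: (cvgr_to_le kh); exact: nearW.
have Lh : Linf mu h.
  by split => //; exists 1; apply: filterS h01 => x /andP[? ?]; rewrite ger0_norm.
exists h; split => //; first by apply: filterS h01 => x /andP[].
have cvg_restr f : L1 mu f ->
    \int[mu]_x `|f x * \1_(A n) x - f x| @[n --> \oo] --> (0 : R).
  move=> f1; have [] // := @dominated_cvg_L1 _ _ _ mu (fun n x => f x * \1_(A n) x)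
    f (fun x => `|f x|).
  - by move=> n; apply: measurable_funM => //; exact: L1_measurable f1.
  - exact: L1_measurable f1.
  - exact: L1_norm.
  - apply: aeW => x; rewrite -[X in _ --> X]mulr1; apply: cvgMr.
    exact: cvg_indic_exhaustion.
  - apply: aeW => x n; rewrite normrM ler_piMr// indicE ger0_norm//.
    by rewrite lern1; case: (_ \in _).
have hM f : L1 mu f -> L1 mu (fun x => h x * f x) by exact: L1_mull.
(* Two computations of the limit of [nu n F]: continuity of [L] along [\1_(F & A n)], and dominated
   convergence of [\1_F * k n] under the bound [\1_F]. *)
have LhF F : measurable F -> (mu F < +oo)%E -> L \1_F = \int[mu]_x (h x * \1_F x).
  move=> mF muF; have F1 := L1_indic mF muF.
  have c1 : nu n F @[n --> \oo] --> L \1_F.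
    apply: Lcvg => [n||]; [exact: I1|by []|].
    rewrite (_ : (fun n => _) =
      (fun n => \int[mu]_x `|\1_F x * \1_(A n) x - \1_F x|)); last first.
      by apply/funext => n; apply: eq_Rintegral => x _; rewrite indicI.
    exact: cvg_restr.
  have [//|||||_ _ c2] := @dominated_cvg_L1 _ _ _ mu (fun n x => \1_F x * k n x)
    (fun x => \1_F x * h x) (\1_F).
  - move=> n; apply: measurable_funM => //; exact: L1_measurable (k1 n).
  - exact: measurable_funM.
  - exact: F1.
  - by apply: filterS kh => x kh; apply: cvgMr.
  - apply: filterS2 (ae_foralln k0) (ae_foralln kle1) => x k0x k1x n.
    by rewrite normrM !ger0_norm// ler_piMr.
  under eq_Rintegral do rewrite mulrC.
  have {}c2 : nu n F @[n --> \oo] --> \int[mu]_x (\1_F x * h x).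
    by rewrite (_ : (fun n => _) = (fun n => \int[mu]_x (\1_F x * k n x)))//;
      apply/funext => n; exact: kint.
  exact: (cvg_unique (@Rhausdorff R) c1 c2).
have Lhs s : simpleL1 mu s -> L s = \int[mu]_x (h x * s x).
  move: s; apply: simpleL1_ind => [//|a s t /simpleL1_L1 s1 /simpleL1_L1 t1 Ls Lt].
  rewrite Llin// Ls Lt -Rintegral_linear; [|exact: hM..].
  by apply: eq_Rintegral => x _; ring.
move=> f f1; apply/eqP; rewrite -subr_eq0 -normr_le0.
apply: ler_addgt0_twice => e /(simpleL1_dense f1)[s s1 fs].
have sL1 := simpleL1_L1 s1; have fs1 := L1_sub f1 sL1.
(* The two functionals agree at [s], and each is a contraction (the second since [0 <= h <= 1]), so
   each contributes at most [e]. *)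
have -> : L f - \int[mu]_x (h x * f x) =
    L (fun x => f x - s x) - \int[mu]_x (h x * (f x - s x)).
  have -> : \int[mu]_x (h x * (f x - s x)) =
      \int[mu]_x (h x * f x) - \int[mu]_x (h x * s x).
    rewrite -RintegralB//; [|exact: hM..].
    by apply: eq_Rintegral => x _; rewrite mulrBr.
  by rewrite LB// (Lhs s)//; ring.
have h_le : \int[mu]_x `|h x * (f x - s x)| <= \int[mu]_x `|f x - s x|.
  apply: ae_le_Rintegral; [exact/L1_norm/hM|exact: L1_norm|].
  apply: filterS h01 => x /andP[h0 h1].
  by rewrite normrM (ger0_norm h0) ler_piMl.
have := le_normr_Rintegral measurableT (hM _ fs1).
have := Lnorm fs1; have := ler_normB (L (fun x => f x - s x))
  (\int[mu]_x (h x * (f x - s x))); lra.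
Qed.

End dual_representation.

(** * Double stochasticity *)

Section doubly_stochastic_criterion.
Context {d : measure_display} {T : measurableType d} {R : realType}.
Variable mu : {measure set T -> \bar R}.
Implicit Types (f g h s t : T -> R).

Lemma cvg_integral_weights_ge0 (psi : nat -> T -> R) g :
  (forall n, measurable_fun setT (psi n)) ->
  (forall n x, 0 <= psi n x) ->
  (forall n x, psi n x <= psi n.+1 x) ->
  (forall x, psi ^~ x @ \oo --> (1 : R)) ->
  measurable_fun setT g -> (forall x, 0 <= g x) ->
  (\int[mu]_x (g x * psi n x)%:E)%E @[n --> \oo] --> (\int[mu]_x (g x)%:E)%E.
Proof.
move=> mpsi psi0 psind psi1 mg g0.
rewrite (eq_integral (fun x => limn (fun n => (g x * psi n x)%:E))); last first.
  move=> x _; apply/esym/cvg_lim => //; apply: cvg_EFin; first exact: nearW.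
  by rewrite -[X in _ --> X]mulr1; apply: cvgMr.
apply: (@cvg_monotone_convergence _ _ _ mu setT measurableT
  (fun n x => (g x * psi n x)%:E)).
- by move=> n; apply/measurable_EFinP; exact: measurable_funM.
- by move=> n x _; rewrite lee_fin mulr_ge0.
- move=> x _; apply/nondecreasing_seqP => n.
  by rewrite lee_fin ler_wpM2l.
Qed.

(** Monotone convergence is applied to the positive and negative parts of [g]; the finiteness of one
    integral keeps the difference of the limits from being of the form infinity minus infinity. *)
Lemma cvg_integral_weights (phi : nat -> T -> R) g :
  (forall n, measurable_fun setT (phi n)) ->
  (forall n, {ae mu, forall x, 0 <= phi n x}) ->
  (forall n, {ae mu, forall x, phi n x <= phi n.+1 x}) ->
  {ae mu, forall x, phi ^~ x @ \oo --> (1 : R)} ->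
  measurable_fun setT g ->
  ((\int[mu]_x (Num.max (g x) 0)%:E < +oo)%E \/
   (\int[mu]_x (Num.max (- g x) 0)%:E < +oo)%E) ->
  (\int[mu]_x (g x * phi n x)%:E)%E @[n --> \oo] --> (\int[mu]_x (g x)%:E)%E.
Proof.
move=> mphi phi0 phind phi1 mg gfin.
have [N [mN N0 subN]] : {ae mu, forall x, [/\ forall n, 0 <= phi n x,
    forall n, phi n x <= phi n.+1 x & phi ^~ x @ \oo --> (1 : R)]}.
  by apply: filterS3 (ae_foralln phi0) (ae_foralln phind) phi1.
have {}subN x : ~ N x -> [/\ forall n, 0 <= phi n x,
    forall n, phi n x <= phi n.+1 x & phi ^~ x @ \oo --> (1 : R)].
  by move=> Nx; apply: contrapT => /(subN x).
(* Replacing the weights by 1 on the exceptional null set [N] makes positivity, monotonicity and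
   convergence hold at every point. *)
pose psi n x := phi n x * \1_(~` N) x + \1_N x.
have psiN n x : N x -> psi n x = 1.
  by move=> Nx; rewrite /psi !indicE memNset ?mulr0 ?add0r ?mem_set//; exact.
have psinN n x : ~ N x -> psi n x = phi n x.
  by move=> Nx; rewrite /psi !indicE mem_set// mulr1 memNset// addr0.
have mpsi n : measurable_fun setT (psi n).
  apply: measurable_funD => //; apply: measurable_funM => //.
  by apply: measurable_indic; exact: measurableC.
have psi0 n x : 0 <= psi n x.
  have [Nx|Nx] := pselect (N x); first by rewrite psiN.
  by rewrite psinN//; have [] := subN _ Nx.
have psind n x : psi n x <= psi n.+1 x.
  have [Nx|Nx] := pselect (N x); first by rewrite !psiN.
  by rewrite !psinN//; have [] := subN _ Nx.
have psi1 x : psi ^~ x @ \oo --> (1 : R).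
  have [Nx|Nx] := pselect (N x).
    by apply: cvg_near_cst; apply: nearW => n; exact: psiN.
  rewrite (_ : psi ^~ x = phi ^~ x); first by have [] := subN _ Nx.
  by apply/funext => n; exact: psinN.
have -> : (fun n => \int[mu]_x (g x * phi n x)%:E)%E =
    (fun n => \int[mu]_x (Num.max (g x) 0 * psi n x)%:E -
              \int[mu]_x (Num.max (- g x) 0 * psi n x)%:E)%E.
  apply/funext => n; rewrite (ae_eq_integral (fun x => (g x * psi n x)%:E))//.
  - rewrite integralE; congr (_ - _)%E; apply: eq_integral => x _.
      rewrite funeposE /= -EFin_max; congr EFin.
      by rewrite maxr_pMl// mul0r.
    rewrite funenegE /= -EFin_max; congr EFin.
    by rewrite maxr_pMl// mul0r mulNr.
  - by apply/measurable_EFinP; exact: measurable_funM.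
  - by apply/measurable_EFinP; exact: measurable_funM.
  - exists N; split => // x /= nx; apply: contrapT => Nx; apply: nx => _.
    by rewrite psinN.
have -> : (\int[mu]_x (g x)%:E = \int[mu]_x (Num.max (g x) 0)%:E -
                                 \int[mu]_x (Num.max (- g x) 0)%:E)%E.
  rewrite integralE; congr (_ - _)%E; apply: eq_integral => x _.
    by rewrite funeposE /= -EFin_max.
  by rewrite funenegE /= -EFin_max.
apply: cvgeB.
- have p0 : (0 <= \int[mu]_x (Num.max (g x) 0)%:E)%E.
    by apply: integral_ge0 => x _; rewrite lee_fin le_max lexx orbT.
  have n0 : (0 <= \int[mu]_x (Num.max (- g x) 0)%:E)%E.
    by apply: integral_ge0 => x _; rewrite lee_fin le_max lexx orbT.
  case: gfin => [pfin|nfin].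
    by apply: fin_num_adde_defr; rewrite ge0_fin_numE.
  by apply: fin_num_adde_defl; rewrite fin_numN ge0_fin_numE.
- apply: cvg_integral_weights_ge0 => //.
    exact: measurable_maxr.
  by move=> x; rewrite le_max lexx orbT.
- apply: cvg_integral_weights_ge0 => //.
    by apply: measurable_maxr => //; exact: measurableT_comp.
  by move=> x; rewrite le_max lexx orbT.
Qed.

Variables (A : nat -> set T) (Top : (T -> R) -> T -> R).
Hypothesis mA : forall n, measurable (A n).
Hypothesis fA : forall n, (mu (A n) < +oo)%E.
Hypothesis ndA : forall n, A n `<=` A n.+1.
Hypothesis UA : \bigcup_n A n = setT.
Hypothesis mTop : markov_op mu Top.

Let A1 n : L1 mu (\1_(A n)). Proof. exact: L1_indic. Qed.

Let TA1 n : L1 mu (Top (\1_(A n))). Proof. exact: (markov_L1 mTop). Qed.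

Let TA0 n : {ae mu, forall x, 0 <= Top (\1_(A n)) x}.
Proof. by apply: (markov_ge0 mTop) => //; exact: aeW. Qed.

Let indic_nd n x : \1_(A n) x <= \1_(A n.+1) x :> R.
Proof.
rewrite !indicE ler_nat; have [/set_mem Ax|//] := boolP (x \in A n).
by rewrite mem_set//; exact: ndA.
Qed.

Let TAnd n : {ae mu, forall x, Top (\1_(A n)) x <= Top (\1_(A n.+1)) x}.
Proof. by apply: (markov_le mTop) => //; apply: aeW => x; exact: indic_nd. Qed.

(** Over a set [G] of finite measure the integrals of [T 1_(A n)] increase to [mu G], so each is at
    most [mu G], whence the bound by 1. The bounded monotone limit then has integral [mu G] over
    every such [G], so it is 1. *)
Lemma markov_exhaustion_cvg :
  (forall E, measurable E -> (mu E < +oo)%E ->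
    (\int[mu]_x (\1_E x * Top (\1_(A n)) x)%:E)%E @[n --> \oo] --> mu E) ->
  (forall n, {ae mu, forall x, Top (\1_(A n)) x <= 1}) /\
  {ae mu, forall x, Top (\1_(A n)) x @[n --> \oo] --> (1 : R)}.
Proof.
move=> Tcvg.
have E1 E f : measurable E -> L1 mu f -> L1 mu (fun x => \1_E x * f x).
  by move=> mE; apply: L1_mull; exact: Linf_indic.
have TcvgR E : measurable E -> (mu E < +oo)%E ->
    \int[mu]_x (\1_E x * Top (\1_(A n)) x) @[n --> \oo] --> \int[mu]_x \1_E x.
  move=> mE muE; have := Tcvg E mE muE.
  have -> : mu E = (\int[mu]_x \1_E x)%:E.
    by rewrite Rintegral_indic// fineK// ge0_fin_numE.
  by move/fine_cvgP => [_].
have IE F m f : \int[mu]_x (\1_F x * (\1_(A m) x * f x)) =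
    \int[mu]_x (\1_(F `&` A m) x * f x).
  by apply: eq_Rintegral => x _; rewrite indicI/= mulrA.
have IE1 F m : \int[mu]_x (\1_F x * \1_(A m) x) = \int[mu]_x \1_(F `&` A m) x.
  by apply: eq_Rintegral => x _; rewrite indicI.
have le1 n : {ae mu, forall x, Top (\1_(A n)) x <= 1}.
  (* The constant 1 need not be integrable, so the comparison by integrals is made on each [A m];
     these cover the space. *)
  have : {ae mu, forall x m, \1_(A m) x * Top (\1_(A n)) x <= \1_(A m) x}.
    apply: ae_foralln => m; apply: ae_le_of_Rintegral => //; first exact: E1.
    move=> F mF; have mG := measurableI _ _ mF (mA m).
    have := TcvgR _ mG (measure_exhaustion_lty mA fA m mF).
    rewrite IE IE1 => c.
    rewrite -(cvg_lim (@Rhausdorff R) c).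
    apply: (nondecreasing_cvgn_le (u_ := fun n => \int[mu]_x (\1_(F `&` A m) x * Top \1_(A n) x))).
      apply/nondecreasing_seqP => j; apply: ae_le_Rintegral; [exact: E1..|].
      by apply: filterS (TAnd j) => x ?; rewrite ler_wpM2l.
    exact: cvgP c.
  apply: filterS => x h; have [m _ Am] : (\bigcup_n A n) x by rewrite UA.
  by have := h m; rewrite indicE mem_set// mul1r.
split => //.
have [h mh hcvg] := ae_bounded_monotone_lim (fun n => L1_measurable (TA1 n)) TAnd le1.
have h_le1 : {ae mu, forall x, 0 <= h x <= 1}.
  apply: filterS3 hcvg (ae_foralln TA0) (ae_foralln le1) => x hx t0 t1.
  apply/andP; split.
    by apply: (cvgr_to_ge hx); exact: nearW.
  by apply: (cvgr_to_le hx); exact: nearW.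
have hinf : Linf mu h.
  by split => //; exists 1; apply: filterS h_le1 => x /andP[? ?]; rewrite ger0_norm.
have hA m : L1 mu (fun x => \1_(A m) x * h x).
  have := L1_mull hinf (A1 m); congr L1; apply/funext => x; exact: mulrC.
have ge1 : {ae mu, forall x m, \1_(A m) x <= \1_(A m) x * h x}.
  apply: ae_foralln => m; apply: ae_le_of_Rintegral => // F mF.
  have mG := measurableI _ _ mF (mA m).
  have muG := measure_exhaustion_lty mA fA m mF.
  rewrite IE IE1.
  have [//|||||_ _ c2] := @dominated_cvg_L1 _ _ _ mu
    (fun n x => \1_(F `&` A m) x * Top (\1_(A n)) x)
    (fun x => \1_(F `&` A m) x * h x) (\1_(F `&` A m)).
  - by move=> n; exact: L1_measurable (E1 _ _ mG (TA1 n)).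
  - exact: measurable_funM.
  - exact: L1_indic.
  - by apply: filterS hcvg => x hx; exact: cvgMr.
  - apply: filterS2 (ae_foralln TA0) (ae_foralln le1) => x t0 t1 n.
    by rewrite normrM !ger0_norm// ler_piMr.
  by rewrite (cvg_unique (@Rhausdorff R) c2 (TcvgR _ mG muG)).
apply: filterS3 hcvg ge1 h_le1 => x hx g1 /andP[_ l1].
have [m _ Am] : (\bigcup_n A n) x by rewrite UA.
have := g1 m; rewrite indicE mem_set// mul1r => g1m.
by have <- : h x = 1 by apply/eqP; rewrite eq_le l1.
Qed.

Lemma adjoint_Rintegral g h f : adjoint_at mu Top g h -> L1 mu f ->
  \int[mu]_x (h x * f x) = \int[mu]_x (g x * Top f x).
Proof. by move=> [_ hT] f1; rewrite /Rintegral hT. Qed.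

(** A change of sign exchanges positive and negative parts, which reduces one finiteness case to the
    other. *)
Lemma adjoint_opp g h : Linf mu g -> adjoint_at mu Top g h ->
  Linf mu (fun x => - g x) /\ adjoint_at mu Top (fun x => - g x) (fun x => - h x).
Proof.
have opp f : Linf mu f -> Linf mu (fun x => - f x).
  move=> [mf [M fM]]; split; first exact: measurableT_comp.
  by exists M; apply: filterS fM => x; rewrite normrN.
move=> gi hT; have [hi _] := hT; split; [exact: opp|split; first exact: opp].
move=> f f1; have Tf1 := markov_L1 mTop f1.
rewrite !L1_integralE; [|exact/L1_mull/Tf1/opp|exact/L1_mull/f1/opp].
have neg k u : Linf mu k -> L1 mu u ->
    \int[mu]_x (- k x * u x) = -1 * \int[mu]_x (k x * u x).
  move=> ki u1; rewrite -RintegralZl//; last exact: L1_mull.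
  by apply: eq_Rintegral => x _; ring.
by rewrite !neg// (adjoint_Rintegral hT).
Qed.

(** * Integrals of functions representing an adjoint *)

Section criterion.
Hypothesis Tle1 : forall n, {ae mu, forall x, Top (\1_(A n)) x <= 1}.

(** Let [S] be the set where [h < 0]. The negative part of [h] over [A n] has integral [- int h 1_(S
    & A n) = - int g (T 1_(S & A n))], which is at most the integral of the negative part of [g]
    because [0 <= T 1_(S & A n) <= T 1_(A n) <= 1]. Then [n] tends to infinity. *)
Lemma adjoint_neg_part_lty g h : Linf mu g -> adjoint_at mu Top g h ->
  (\int[mu]_x (Num.max (- g x) 0)%:E < +oo)%E ->
  (\int[mu]_x (Num.max (- h x) 0)%:E < +oo)%E.
Proof.
move=> gi hT gfin; have [[mh hb] _] := hT.
have [mg gb] := gi.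
have gn1 : L1 mu (fun x => Num.max (- g x) 0).
  apply/integrableP; split.
    by apply/measurable_EFinP/measurable_maxr => //; exact: measurableT_comp.
  by under eq_integral do rewrite /= ger0_norm ?le_max ?lexx ?orbT//.
apply: le_lt_trans gfin.
pose S := [set x | h x < 0].
have mS : measurable S.
  have := measurable_fun_ltr mh (@measurable_cst _ _ _ _ setT (0 : R)).
  by move=> /(_ measurableT [set true]); rewrite setTI; exact.
have := @cvg_integral_weights_ge0 (fun n => \1_(A n)) (fun x => Num.max (- h x) 0).
move=> /(_ _ _ _ (cvg_indic_exhaustion ndA UA)) => /(_ _ _ _ _ _)-c.
apply: (cvge_to_le (c _ _ _ _ _)) => //.
- by apply: measurable_maxr => //; exact: measurableT_comp.
- by move=> x; rewrite le_max lexx orbT.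
apply: nearW => n.
have mF := measurableI _ _ mS (mA n).
have muF := measure_exhaustion_lty mA fA n mS.
have F1 := L1_indic mF muF.
have TF1 := markov_L1 mTop F1.
rewrite (eq_integral (fun x => (- (h x * \1_(S `&` A n) x))%:E)); last first.
  move=> x _; congr EFin; rewrite indicI/= [\1_S x]indicE.
  have [/set_mem Sx|/negP nSx] := boolP (x \in S).
    by rewrite mul1r -mulNr; congr (_ * _); apply/max_idPl; rewrite oppr_ge0 ltW.
  rewrite mul0r mulr0 oppr0 (_ : Num.max _ _ = 0) ?mul0r//.
  apply/max_idPr; rewrite oppr_le0 leNgt; apply/negP => hx.
  by apply: nSx; rewrite inE.
rewrite (L1_integralE gn1) L1_integralE; last exact/L1_opp/L1_mull/F1.
rewrite lee_fin.
have -> : \int[mu]_x (- (h x * \1_(S `&` A n) x)) =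
    \int[mu]_x (- (g x * Top (\1_(S `&` A n)) x)).
  have neg u : L1 mu u -> \int[mu]_x (- u x) = -1 * \int[mu]_x u x.
    move=> u1; rewrite -RintegralZl//.
    by apply: eq_Rintegral => x _; ring.
  have hF1 : L1 mu (fun x => h x * \1_(S `&` A n) x) by exact: L1_mull.
  by rewrite (neg _ hF1) (neg _ (L1_mull gi TF1)) (adjoint_Rintegral hT F1).
apply: ae_le_Rintegral => //; first exact/L1_opp/L1_mull.
have T0 : {ae mu, forall x, 0 <= Top (\1_(S `&` A n)) x}.
  by apply: (markov_ge0 mTop F1); exact: aeW.
have TleA : {ae mu, forall x, Top (\1_(S `&` A n)) x <= Top (\1_(A n)) x}.
  apply: (markov_le mTop F1 (A1 n)); apply: aeW => x.
  rewrite !indicE ler_nat; have [/set_mem[_ Ax]|//] := boolP (x \in S `&` A n).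
  by rewrite mem_set.
apply: filterS3 T0 TleA (Tle1 n) => x t0 tA t1.
have {tA}t1 := le_trans tA t1; rewrite -mulNr.
have [g0|g0] := leP 0 (- g x); first by rewrite ler_piMr.
by rewrite mulr_le0_ge0// ltW.
Qed.

Hypothesis Tcvg : {ae mu, forall x, Top (\1_(A n)) x @[n --> \oo] --> (1 : R)}.

Lemma adjoint_integral g h : Linf mu g -> adjoint_at mu Top g h ->
  ((\int[mu]_x (Num.max (g x) 0)%:E < +oo)%E \/
   (\int[mu]_x (Num.max (- g x) 0)%:E < +oo)%E) ->
  (\int[mu]_x (h x)%:E = \int[mu]_x (g x)%:E)%E.
Proof.
move=> gi hT gfin; have [[mh hb] hTE] := hT; have [mg gb] := gi.
(* The finite part of [g] is inherited by [h]; this is needed before the weights [\1_(A n)] may be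
   removed from the integral of [h]. *)
have hfin : (\int[mu]_x (Num.max (h x) 0)%:E < +oo)%E \/
    (\int[mu]_x (Num.max (- h x) 0)%:E < +oo)%E.
  case: gfin => [gp|gn]; [left|right; exact: adjoint_neg_part_lty gn].
  have [gi' hT'] := adjoint_opp gi hT.
  have oppK f : (\int[mu]_x (Num.max (- - f x) 0)%:E =
                 \int[mu]_x (Num.max (f x) 0)%:E)%E.
    by apply: eq_integral => x _; rewrite opprK.
  by have := adjoint_neg_part_lty gi' hT'; rewrite !oppK; exact.
have ch : (\int[mu]_x (h x * \1_(A n) x)%:E)%E @[n --> \oo] --> (\int[mu]_x (h x)%:E)%E.
  apply: (@cvg_integral_weights (fun n => \1_(A n)) h) => //.
  - by move=> n; exact: aeW.
  - by move=> n; apply: aeW => x; exact: indic_nd.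
  - by apply: aeW => x; exact: cvg_indic_exhaustion.
have cg : (\int[mu]_x (g x * Top (\1_(A n)) x)%:E)%E @[n --> \oo] -->
    (\int[mu]_x (g x)%:E)%E.
  apply: (@cvg_integral_weights (fun n => Top (\1_(A n))) g) => //.
  by move=> n; exact: L1_measurable (TA1 n).
have {}ch : (\int[mu]_x (g x * Top (\1_(A n)) x)%:E)%E @[n --> \oo] -->
    (\int[mu]_x (h x)%:E)%E.
  rewrite (_ : (fun n => _) = (fun n => \int[mu]_x (h x * \1_(A n) x)%:E)%E)//.
  by apply/funext => n; rewrite hTE.
exact: (cvg_unique (@ereal_hausdorff R) ch cg).
Qed.

End criterion.

Lemma indic_neg_part_lty E : measurable E ->
  (\int[mu]_x (Num.max (- \1_E x : R) 0)%:E < +oo)%E.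
Proof.
move=> mE; under eq_integral.
  move=> x _; rewrite (_ : Num.max _ _ = 0); last by apply/max_idPr; rewrite oppr_le0.
  over.
by rewrite integral0 ltry.
Qed.

Lemma doubly_stochastic_of_cvg :
  (forall E, measurable E -> (mu E < +oo)%E ->
    (\int[mu]_x (\1_E x * Top (\1_(A n)) x)%:E)%E @[n --> \oo] --> mu E) ->
  doubly_stochastic mu Top.
Proof.
move=> /markov_exhaustion_cvg[Tle1 Tcvg]; split; [split => //|].
- move=> E mE muE h hT; rewrite (adjoint_integral Tle1 Tcvg _ hT).
  + by rewrite integral_indic// setIT.
  + exact: Linf_indic.
  + by right; exact: indic_neg_part_lty.
- by move=> g gi gfin h hT; exact: adjoint_integral hT gfin.
Qed.

(** The functional sending [f] to the integral of [T f] over [E] is positive, and for [f >= 0] it is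
    at most [int T f = int f], so it has the form required by [L1_dual_representation]. *)
Lemma adjoint_indic_exists E : sigma_finite setT mu -> measurable E ->
  exists2 h, adjoint_at mu Top (\1_E) h & {ae mu, forall x, 0 <= h x}.
Proof.
move=> sf mE.
have EL f : L1 mu f -> L1 mu (fun x => \1_E x * Top f x).
  move=> f1; apply: L1_mull; first exact: Linf_indic.
  exact: (markov_L1 mTop).
have [||h [hi h0 hint]] := @L1_dual_representation _ _ _ mu A sf mA fA ndA UA
  (fun f => \int[mu]_x (\1_E x * Top f x)).
- move=> a f g f1 g1; rewrite -Rintegral_linear; [|exact: EL..].
  apply: ae_eq_Rintegral.
  + exact: L1_measurable (EL _ (L1_linear a f1 g1)).
  + exact: L1_measurable (L1_linear a (EL _ f1) (EL _ g1)).
  + by apply: filterS (markov_linear mTop a f1 g1) => x ->; ring.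
- move=> f f1 f0; have Tf0 := markov_ge0 mTop f1 f0.
  have Tf1 := markov_L1 mTop f1.
  apply/andP; split.
    have c0 : L1 mu (cst 0) by exact: integrable0.
    have := ae_le_Rintegral c0 (EL _ f1); rewrite Rintegral_cst// mul0r; apply.
    by apply: filterS Tf0 => x ?; rewrite mulr_ge0.
  rewrite -(markov_Rintegral mTop f1); apply: ae_le_Rintegral => //; first exact: EL.
  by apply: filterS Tf0 => x ?; rewrite ler_piMl// indicE lern1; case: (_ \in _).
exists h => //; split => // f f1.
by rewrite !L1_integralE ?hint//; [exact: EL|exact: L1_mull].
Qed.

Lemma doubly_stochastic_cvg : sigma_finite setT mu -> doubly_stochastic mu Top ->
  forall E, measurable E -> (mu E < +oo)%E ->
    (\int[mu]_x (\1_E x * Top (\1_(A n)) x)%:E)%E @[n --> \oo] --> mu E.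
Proof.
move=> sf [_ ds] E mE muE; have [h hT h0] := adjoint_indic_exists sf mE.
have [[mh _] hTE] := hT.
have <- : (\int[mu]_x (h x)%:E = mu E)%E.
  rewrite (ds (\1_E) _ _ h hT); first by rewrite integral_indic// setIT.
    exact: Linf_indic.
  by right; exact: indic_neg_part_lty.
rewrite (_ : (fun n => _) = (fun n => \int[mu]_x (h x * \1_(A n) x)%:E)%E); last first.
  by apply/funext => n; rewrite hTE.
apply: (@cvg_integral_weights (fun n => \1_(A n)) h) => //.
- by move=> n; exact: aeW.
- by move=> n; apply: aeW => x; exact: indic_nd.
- by apply: aeW => x; exact: cvg_indic_exhaustion.
(* Since [h >= 0] almost everywhere, its negative part has integral 0. *)
- right; rewrite (ae_eq_integral (cst 0%E)) ?integral0 ?ltry//.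
    by apply/measurable_EFinP/measurable_maxr => //; exact: measurableT_comp.
  by apply: filterS h0 => x hx _; congr EFin; apply/max_idPr; rewrite oppr_le0.
Qed.

End doubly_stochastic_criterion.

Theorem theorem3p1 (d : measure_display) (T : measurableType d) (R : realType)
  (mu : {measure set T -> \bar R}) (A : nat -> set T)
  (D : (T -> R) -> (T -> R)) :
  sigma_finite setT mu ->
  (forall n, measurable (A n)) ->
  (forall n, (mu (A n) < +oo)%E) ->
  (forall n, A n `<=` A n.+1) ->
  \bigcup_n A n = setT ->
  simple_linear_map mu D ->
  (unique_ds_extension mu D <->
   (nonneg_map mu D /\
    forall E, measurable E -> (mu E < +oo)%E ->
      (\int[mu]_x (D (\1_E) x)%:E = mu E)%E /\
      ((fun n => (\int[mu]_x (\1_E x * D (\1_(A n)) x)%:E)%E) @ \oo --> mu E))).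
Proof.
move=> sf mA fA ndA UA Dlin.
have [DL1 _] := Dlin.
(* An extension agrees with [D] only almost everywhere, so the two limit conditions are identified
   through their integrals. *)
have Aint Top E n : markov_op mu Top -> extends mu Top D -> measurable E ->
    (\int[mu]_x (\1_E x * Top (\1_(A n)) x)%:E =
     \int[mu]_x (\1_E x * D (\1_(A n)) x)%:E)%E.
  move=> mTop ext mE; have An := simpleL1_indic (mA n) (fA n).
  have Ei := Linf_indic mu mE.
  apply: ae_eq_integral => //.
  - exact: measurable_int (L1_mull Ei (markov_L1 mTop (simpleL1_L1 An))).
  - exact: measurable_int (L1_mull Ei (DL1 _ An)).
  - by apply: filterS (ext _ An) => x -> _.
split=> [[Top [ds [ext _]]]|[D0 DE]].
  have [[mTop _] _] := ds; split.
    move=> s s1 s0; have := markov_ge0 mTop (simpleL1_L1 s1) s0.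
    by apply: filterS2 (ext _ s1) => x ->.
  move=> E mE muE; have E1 := simpleL1_indic mE muE; split.
    transitivity (\int[mu]_x (Top (\1_E) x)%:E)%E.
      apply: ae_eq_integral => //.
      - exact: measurable_int (DL1 _ E1).
      - exact: measurable_int (markov_L1 mTop (simpleL1_L1 E1)).
      - by apply: filterS (ext _ E1) => x -> _.
    case: mTop => _ [_ ->]; last exact: simpleL1_L1.
    by rewrite integral_indic// setIT.
  have := doubly_stochastic_cvg mA fA ndA UA mTop sf ds mE muE.
  by rewrite (_ : (fun n => _) =
    (fun n => \int[mu]_x (\1_E x * D (\1_(A n)) x)%:E)%E)//; apply/funext => n; exact: Aint.
have [Top mTop [ext uniq]] :=
  markov_extension Dlin D0 (fun E mE muE => (DE E mE muE).1).
exists Top; split; last split => //.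
  apply: (doubly_stochastic_of_cvg mA fA ndA UA mTop) => E mE muE.
  rewrite (_ : (fun n => _) =
    (fun n => \int[mu]_x (\1_E x * D (\1_(A n)) x)%:E)%E); first by case: (DE E mE muE).
  by apply/funext => n; exact: Aint.
(* Uniqueness comes from the larger class of Markov operators. *)
by move=> Top' [[mTop' _] _]; exact: uniq.
Qed.
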